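(* Let $A \in \mathbb{R}^{n \times n}$ be a $\mathbf{Z}$-matrix that is also an $\mathbf{E_{0_2}}$-matrix. Then the following statements hold: (a) All proper principal minors of $A$ of order at most $n-2$ are nonnegative. (b) All proper principal minors of $A$ of order $n-1$ are negative. (c) $\det A < 0$. (d) The inverse $A^{-1}$ exists, and all diagonal entries of $A^{-1}$ are positive.
   Context: All matrices are real. A matrix $M \in \mathbb{R}^{m\times m}$ is semimonotone if for every $0 \neq x \geq 0$ (entrywise) there is an index $i$ with $x_i > 0$ and $(Mx)_i \geq 0$. A matrix $A \in \mathbb{R}^{n\times n}$ is an $\mathbf{E_{0_2}}$-matrix (semimonotone of exact order $2$) if every principal submatrix of $A$ of order $n-2$ is semimonotone, but no principal submatrix of $A$ of order $n-1$ or $n$ is semimonotone. A $\mathbf{Z}$-matrix is a real square matrix whose off-diagonal entries are all nonpositive. A principal minor of order $r$ is the determinant of an $r \times r$ principal submatrix (same row and column index set).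
   Formalization: The formal theorem assumes n ≥ 3, so that principal submatrices of order n-2 are nonempty; for n = 2 that condition is vacuous and the claim fails, e.g. A = -I has det A = 1 > 0. *)

(* Defs.v *)
From HB Require Import structures.
From mathcomp Require Import all_boot all_order all_algebra reals.

Set Implicit Arguments.
Unset Strict Implicit.
Unset Printing Implicit Defensive.

Import Order.TTheory GRing.Theory Num.Theory.
Local Open Scope ring_scope.

Definition semimonotone (R : realType) (m : nat) (M : 'M[R]_m) : Prop :=
  forall x : 'cV[R]_m, x != 0 -> (forall i, 0 <= x i 0) ->
    exists i, 0 < x i 0 /\ 0 <= (M *m x) i 0.

(* Rows and columns are both listed in the increasing order of J. *)
Definition principal_submx (R : realType) (n : nat) (A : 'M[R]_n)
    (J : {set 'I_n}) : 'M[R]_#|J| :=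
  mxsub (@enum_val _ (mem J)) (@enum_val _ (mem J)) A.

Definition principal_minor (R : realType) (n : nat) (A : 'M[R]_n)
    (J : {set 'I_n}) : R :=
  \det (principal_submx A J).

Definition Z_matrix (R : realType) (n : nat) (A : 'M[R]_n) : Prop :=
  forall i j, i != j -> A i j <= 0.

(* Only meaningful for 2 < n, so that n - 2 is the order of a nonempty
   principal submatrix: for n = 2 the order-0 condition is vacuous, and then
   -1%:M would qualify although its determinant is 1. *)
Definition E02_matrix (R : realType) (n : nat) (A : 'M[R]_n) : Prop :=
  (forall J : {set 'I_n}, #|J| = (n - 2)%N ->
     semimonotone (principal_submx A J)) /\
  (forall J : {set 'I_n}, #|J| = (n - 1)%N \/ #|J| = n ->
     ~ semimonotone (principal_submx A J)).

(* Main.v *)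
(** If a Z-matrix M is semimonotone and t > 0, then M + t I is nonsingular: a
    kernel vector v would make every entry of (M + t I) |v| nonpositive. As
    the characteristic polynomial of - M is monic, it has no sign change on
    t > 0, so det M >= 0.

    A principal submatrix M of order n - 1 has semimonotone proper principal
    submatrices and admits x > 0 with M x < 0. Subtracting from any u the
    multiple r x with r = min_i u_i / x_i shows that M u <= 0 forces u >= 0,
    so M is nonsingular, and so is M + t I for small t >= 0. For t > 0,
    adj (M + t I) >= 0; applied to (M + t I) x < 0 this gives
    det (M + t I) <= 0, whence det M < 0.

    For A itself, deleting the index k shows that if y_k <= 0 and
    (A y)_i <= 0 for i <> k, then y_i >= 0 for i <> k. With three indices
    available, this kills every kernel vector; and for y the k-th column of
    adj A it makes row k of A y = (det A) e_k nonpositive. *)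

Require Import Defs.
From HB Require Import structures.
From mathcomp Require Import all_boot all_order all_algebra reals.
From mathcomp Require Import boolp lra polyrcf.

Set Implicit Arguments.
Unset Strict Implicit.
Unset Printing Implicit Defensive.

Import Order.TTheory GRing.Theory Num.Theory.
Local Open Scope ring_scope.

(** * Submatrices along an injection *)

(* [colsub f 1%:M *m x] is the extension of [x] by zero along [f]. *)
Lemma extend_mx_in (R : realType) (m n : nat) (f : 'I_m -> 'I_n) (x : 'cV[R]_m)
    (i : 'I_m) : injective f ->
  (colsub f 1%:M *m x) (f i) 0 = x i 0.
Proof.
move=> f_inj; rewrite mxE (bigD1 i) //= !mxE eqxx mul1r big1 ?addr0 // => k ki.
by rewrite !mxE (inj_eq f_inj) eq_sym (negPf ki) mul0r.
Qed.

Lemma extend_mx_out (R : realType) (m n : nat) (f : 'I_m -> 'I_n)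
    (x : 'cV[R]_m) (j : 'I_n) : j \notin codom f ->
  (colsub f 1%:M *m x) j 0 = 0.
Proof.
move=> jf; rewrite mxE big1 // => k _; rewrite !mxE.
by case: eqP => [jk|]; rewrite ?mul0r //; rewrite jk codom_f in jf.
Qed.

Lemma mxsub_mul (R : realType) (m n : nat) (f : 'I_m -> 'I_n) (A : 'M[R]_n)
    (x : 'cV[R]_m) (i : 'I_m) :
  (mxsub f f A *m x) i 0 = (A *m (colsub f 1%:M *m x)) (f i) 0.
Proof.
by rewrite mulmxA mulmx_colsub mulmx1 !mxE; apply: eq_bigr => k _; rewrite !mxE.
Qed.

(** Zero entries outside the image of [f] never serve as the required index, so extension by zero
    keeps the test intact and later arguments stay in the coordinates of [A]. *)
Lemma semimonotone_mxsub (R : realType) (m n : nat) (f : 'I_m -> 'I_n)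
    (A : 'M[R]_n) : injective f ->
  semimonotone (mxsub f f A) <->
  (forall x : 'cV[R]_n, x != 0 -> (forall i, 0 <= x i 0) ->
     (forall i, i \notin codom f -> x i 0 = 0) ->
     exists i, 0 < x i 0 /\ 0 <= (A *m x) i 0).
Proof.
move=> f_inj; split=> H x x0 xge.
  move=> xout; pose y := rowsub f x.
  have xE : x = colsub f 1%:M *m y.
    apply/colP => j; case: (boolP (j \in codom f)) => [/codomP[i ->]|jf].
      by rewrite extend_mx_in // mxE.
    by rewrite xout // extend_mx_out.
  have [|i|i [yi Ai]] := H y.
  - by apply: contraNneq x0 => y0; rewrite xE y0 mulmx0.
  - by rewrite mxE.
  - by exists (f i); rewrite {2}xE -mxsub_mul; rewrite mxE in yi.
have [| j |j /extend_mx_out -> //|j []] := H (colsub f 1%:M *m x).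
- apply: contraNneq x0 => y0; apply/eqP/colP => i.
  by rewrite -(extend_mx_in x i f_inj) y0 !mxE.
- case: (boolP (j \in codom f)) => [/codomP[i ->]|jf].
    by rewrite extend_mx_in.
  by rewrite extend_mx_out.
- case: (boolP (j \in codom f)) => [/codomP[i ->]|jf].
    by rewrite extend_mx_in // -mxsub_mul; exists i.
  by rewrite extend_mx_out // ltxx.
Qed.

Lemma Z_matrix_mxsub (R : realType) (m n : nat) (f : 'I_m -> 'I_n)
    (A : 'M[R]_n) : injective f -> Z_matrix A -> Z_matrix (mxsub f f A).
Proof. by move=> f_inj ZA i j ij; rewrite mxE ZA // (inj_eq f_inj). Qed.

(** * Shifted determinants of semimonotone Z-matrices *)

Lemma semimonotone_diag_ge0 (R : realType) (m : nat) (M : 'M[R]_m) (i : 'I_m) :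
  semimonotone M -> 0 <= M i i.
Proof.
move=> /(_ (delta_mx i 0)) [|k|k []].
- by apply/eqP => /colP/(_ i)/eqP; rewrite !mxE !eqxx oner_eq0.
- by rewrite !mxE ler0n.
- rewrite mxE andbT; have [-> _|_] := eqVneq k i; last by rewrite ltxx.
  by rewrite -colE mxE.
Qed.

Lemma horner_char_polyN (R : realType) (m : nat) (M : 'M[R]_m) (t : R) :
  (char_poly (- M)).[t] = \det (M + t%:M).
Proof.
rewrite /char_poly -horner_evalE -det_map_mx; congr (\det _).
apply/matrixP => i j; rewrite !mxE /= horner_evalE.
rewrite hornerD hornerN hornerMn hornerX hornerC.
by rewrite opprK addrC.
Qed.

Lemma monic_le0_root (R : realType) (p : {poly R}) (a : R) :
  p \is monic -> p.[a] <= 0 -> exists2 c, a <= c & root p c.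
Proof.
move=> /monicP lp pa.
have [|b pb] := @poly_pinfty_gt_lc R p; first by rewrite lp.
have [||c /andP[ac _] rc] := @poly_ivt R p a (Num.max a b).
- by rewrite le_max lexx.
- by rewrite pa; apply: le_trans (pb _ _); rewrite ?lp // le_max lexx orbT.
- by exists c.
Qed.

Lemma Z_semimonotone_det_neq0 (R : realType) (m : nat) (M : 'M[R]_m) (t : R) :
  Z_matrix M -> semimonotone M -> 0 < t -> \det (M + t%:M) != 0.
Proof.
move=> ZM sM t0; rewrite -det_tr; apply/det0P => -[v v0 vM].
have {}vM : (M + t%:M) *m v^T = 0.
  by rewrite -[_ *m _]trmxK trmx_mul trmxK vM trmx0.
have [|i|i []] := sM (\col_i `|v 0 i|).
- apply: contraNneq v0 => /colP v0; apply/eqP/rowP => i.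
  by have := v0 i; rewrite !mxE => /normr0P/eqP.
- by rewrite mxE.
rewrite !mxE normr_gt0 => vi; rewrite leNgt => /negP; apply.
have /(congr1 (fun z : 'cV_m => z i 0)) := vM.
rewrite mulmxDl mul_scalar_mx !mxE (bigD1 i) //= mxE => E.
rewrite (bigD1 i) //= mxE; move: E.
set S := \sum_(j | _) _; set S' := \sum_(j | _) _.
(* Off-diagonal entries are nonpositive, so each term of [S'] is minus the absolute value of the
   matching term of [S]. *)
have SS : S' <= - `|S|.
  rewrite lerNr -sumrN; apply: le_trans (ler_norm_sum _ _ _) _.
  apply: ler_sum => j ji; rewrite !mxE normrM ler0_norm ?mulNr //.
  by rewrite ZM // eq_sym.
have Mi := semimonotone_diag_ge0 i sM.
move=> E; have {}E : S = - ((M i i + t) * v 0 i) by lra.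
move: SS; rewrite E normrN normrM ger0_norm; last lra.
have : 0 < t * `|v 0 i| by rewrite mulr_gt0 // normr_gt0.
by lra.
Qed.

Lemma Z_semimonotone_det_ge0 (R : realType) (m : nat) (M : 'M[R]_m) (t : R) :
  Z_matrix M -> semimonotone M -> 0 <= t -> 0 <= \det (M + t%:M).
Proof.
move=> ZM sM t0; rewrite leNgt; apply/negP => dlt0.
have [|c tc] := @monic_le0_root R (char_poly (- M)) t (char_poly_monic _).
  by rewrite horner_char_polyN ltW.
(* The strict sign at [t] excludes [c = t]; otherwise [c > t >= 0], where nonvanishing is known. *)
have := tc; rewrite le_eqVlt => /predU1P[<-|/(le_lt_trans t0) c0].
  by rewrite /root horner_char_polyN lt_eqF.
by rewrite /root horner_char_polyN (negPf (Z_semimonotone_det_neq0 _ _ _)).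
Qed.

(** * Matrices with semimonotone proper principal submatrices *)

Definition proper_semimonotone (R : realType) (m : nat) (M : 'M[R]_m) : Prop :=
  forall (k : 'I_m) (x : 'cV[R]_m), x != 0 -> (forall i, 0 <= x i 0) ->
    x k 0 = 0 -> exists i, 0 < x i 0 /\ 0 <= (M *m x) i 0.

(** The minimum of [u_i / x_i] is the largest [r] with [u - r x >= 0]; [i0] makes the index set
    nonempty. *)
Lemma min_ratio (R : realType) (m : nat) (i0 : 'I_m) (x u : 'cV[R]_m) :
  (forall i, 0 < x i 0) ->
  exists k r, u k 0 = r * x k 0 /\ forall i, r * x i 0 <= u i 0.
Proof.
move=> x0.
case: (@Order.TotalTheory.arg_minP _ _ _ i0 xpredT
  (fun i => u i 0 / x i 0)) => // k _ kmin.
exists k, (u k 0 / x k 0); split; first by rewrite divfK // gt_eqF.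
by move=> i; rewrite -ler_pdivlMr // kmin.
Qed.

Lemma proper_semimonotone_inv (R : realType) (m : nat) (M : 'M[R]_m)
    (x u : 'cV[R]_m) :
  proper_semimonotone M -> (forall i, 0 < x i 0) ->
  (forall i, (M *m x) i 0 < 0) -> (forall i, (M *m u) i 0 <= 0) ->
  forall i, 0 <= u i 0.
Proof.
move=> pM x0 Mx Mu i; have [k [r [uk ru]]] := min_ratio i u x0.
have [r0|r0] := leP 0 r; first by rewrite (le_trans _ (ru i)) // mulr_ge0 // ltW.
(* For [r < 0] this [z] is nonnegative, vanishes at [k] and satisfies [M z < 0], which contradicts
   [pM]. *)
pose z := u - r *: x.
have Mz j : (M *m z) j 0 < 0.
  rewrite mulmxBr -scalemxAr !mxE; have := Mu j; have := Mx j; rewrite !mxE.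
  by rewrite -(nmulr_rgt0 _ r0); lra.
have [|j||j [_]] := pM k z.
- by apply/eqP => z0; have := Mz i; rewrite z0 mulmx0 mxE ltxx.
- by rewrite !mxE subr_ge0.
- by rewrite !mxE uk subrr.
- by rewrite leNgt Mz.
Qed.

Lemma proper_semimonotone_det_neq0 (R : realType) (m : nat) (M : 'M[R]_m)
    (x : 'cV[R]_m) :
  proper_semimonotone M -> (forall i, 0 < x i 0) ->
  (forall i, (M *m x) i 0 < 0) -> \det M != 0.
Proof.
move=> pM x0 Mx; rewrite -det_tr; apply/det0P => -[v /eqP v0 vM].
have {}vM : M *m v^T = 0.
  by rewrite -[_ *m _]trmxK trmx_mul trmxK vM trmx0.
apply: v0; apply/rowP => i; apply/eqP; rewrite mxE eq_le.
have := proper_semimonotone_inv (u := v^T) pM x0 Mx _ i.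
have := proper_semimonotone_inv (u := - v^T) pM x0 Mx _ i.
rewrite !mxE oppr_ge0 => -> => [->//|]; move=> j; rewrite ?mulmxN vM ?oppr0 mxE //.
Qed.

Lemma proper_semimonotoneD (R : realType) (m : nat) (M : 'M[R]_m) (t : R) :
  0 <= t -> proper_semimonotone M -> proper_semimonotone (M + t%:M).
Proof.
move=> t0 pM k x x0 xge xk; have [i [xi Mx]] := pM k x x0 xge xk.
exists i; split=> //; rewrite mulmxDl mul_scalar_mx mxE [in X in _ + X]mxE.
by rewrite addr_ge0 // mulr_ge0.
Qed.

Lemma proper_semimonotoneP (R : realType) (m : nat) (M : 'M[R]_m) :
  proper_semimonotone M <->
  forall k : 'I_m, semimonotone (mxsub (lift k) (lift k) M).
Proof.
split=> H k => [|x x0 xge xk].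
  apply/(semimonotone_mxsub _ (@lift_inj _ k)) => x x0 xge xout.
  apply: (H k) => //; apply: xout; apply/codomP => -[i /eqP].
  by rewrite (negPf (neq_lift _ _)).
have /(semimonotone_mxsub _ (@lift_inj _ k)) := H k; apply=> // i ik.
have [<- //|/unlift_some[j ij _]] := eqVneq k i.
by rewrite ij codom_f in ik.
Qed.

Lemma cofactor_mxsub (R : realType) (m : nat) (M : 'M[R]_m) (j : 'I_m) :
  cofactor M j j = \det (mxsub (lift j) (lift j) M).
Proof.
rewrite /cofactor -signr_odd oddD addbb mul1r; congr (\det _).
by apply/matrixP => a b; rewrite !mxE.
Qed.

Lemma proper_semimonotone_cofactor_ge0 (R : realType) (m : nat) (M : 'M[R]_m)
    (t : R) (j : 'I_m) :
  Z_matrix M -> proper_semimonotone M -> 0 <= t ->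
  0 <= cofactor (M + t%:M) j j.
Proof.
move=> ZM pM t0; rewrite cofactor_mxsub.
have -> : mxsub (lift j) (lift j) (M + t%:M) = mxsub (lift j) (lift j) M + t%:M.
  by apply/matrixP => a b; rewrite !mxE (inj_eq lift_inj).
apply: Z_semimonotone_det_ge0 => //; first exact: Z_matrix_mxsub lift_inj ZM.
by move: pM => /proper_semimonotoneP; apply.
Qed.

Lemma mul_adj_col (R : realType) (m : nat) (M : 'M[R]_m) (i j : 'I_m) :
  (M *m col j (\adj M)) i 0 = (\det M) *+ (i == j).
Proof. by rewrite colE mulmxA mul_mx_adj mul_scalar_mx !mxE andbT mulr_natr. Qed.

(** The negative part [z] of column [j] must vanish. It is zero at [j], where the cofactor is
    nonnegative. If [z_k > 0], then [(N y)_k = 0], so [(N z)_k = (N w)_k <= 0] and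
    [(M z)_k <= - t z_k < 0], against [pM]. *)
Lemma proper_semimonotone_adj_ge0 (R : realType) (m : nat) (M : 'M[R]_m)
    (t : R) (i j : 'I_m) :
  Z_matrix M -> proper_semimonotone M -> 0 < t -> 0 <= (\adj (M + t%:M)) i j.
Proof.
move=> ZM pM t0; set N := M + t%:M; pose y := col j (\adj N).
have yj : 0 <= y j 0.
  by rewrite !mxE; apply: proper_semimonotone_cofactor_ge0 => //; exact: ltW.
have Ny k : (N *m y) k 0 = \det N *+ (k == j) by exact: mul_adj_col.
have -> : \adj N i j = y i 0 by rewrite [RHS]mxE.
clearbody y; pose z : 'cV[R]_m := \col_k Num.max 0 (- y k 0).
pose w : 'cV[R]_m := \col_k Num.max 0 (y k 0).
have zE : z = w - y.
  by apply/colP => k; rewrite !mxE;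
    case: (leP 0 (y k 0)); case: (leP 0 (- y k 0)); lra.
suff : z = 0.
  move=> /colP/(_ i); rewrite !mxE; case: (leP 0 (- y i 0)); lra.
apply/eqP; apply/negP => /negP z0.
have [k|| k [zk]] := pM j z z0.
- by rewrite mxE le_max lexx.
- by rewrite mxE max_l // oppr_le0.
rewrite leNgt => /negP; apply.
have yk : y k 0 < 0.
  by move: zk; rewrite mxE lt_max ltxx /= oppr_gt0.
have kj : k != j by apply: contraTneq yk => ->; rewrite -leNgt.
have : (N *m z) k 0 <= 0.
  rewrite zE mulmxBr mxE [X in _ + X]mxE Ny (negPf kj) subr0 mxE.
  apply: sumr_le0 => l _; rewrite [w l 0]mxE.
  have [<-|kl] := eqVneq k l; first by rewrite max_l ?mulr0 // ltW.
  rewrite mulr_le0_ge0 ?le_max ?lexx // mxE [X in _ + X]mxE (negPf kl) addr0.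
  exact: ZM.
rewrite mulmxDl mul_scalar_mx mxE [X in _ + X <= _]mxE.
have := mulr_gt0 t0 zk; lra.
Qed.

Lemma proper_semimonotone_det_lt0 (R : realType) (m : nat) (M : 'M[R]_m)
    (x : 'cV[R]_m) :
  (0 < m)%N -> Z_matrix M -> proper_semimonotone M -> (forall i, 0 < x i 0) ->
  (forall i, (M *m x) i 0 < 0) -> \det M < 0.
Proof.
move=> m0 ZM pM x0 Mx; pose i0 := Ordinal m0.
(* Here [r] is the minimum of [- (M x)_i / x_i], so [(M + t I) x] stays negative for all [t < r]. *)
have [k [r [rk rmin]]] := min_ratio i0 (- (M *m x)) x0.
have r0 : 0 < r by rewrite -(pmulr_lgt0 _ (x0 k)) -rk mxE oppr_gt0.
have Mtx t i : t < r -> ((M + t%:M) *m x) i 0 < 0.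
  move=> tr; rewrite mulmxDl mul_scalar_mx mxE [X in _ + X]mxE.
  have := rmin i; rewrite mxE.
  have : t * x i 0 < r * x i 0 by rewrite ltr_pM2r.
  lra.
have nz t : 0 <= t -> t < r -> \det (M + t%:M) != 0.
  move=> t0 tr; apply: (proper_semimonotone_det_neq0 (x := x)) => //.
    exact: proper_semimonotoneD.
  by move=> i; apply: Mtx.
pose t := r / 2; have t0 : 0 < t by rewrite divr_gt0.
have tr : t < r by rewrite /t; lra.
have dt : \det (M + t%:M) <= 0.
  rewrite -(pmulr_lle0 _ (x0 i0)).
  have := mul_adj_mx (M + t%:M) => /(congr1 (mulmx^~ x)).
  rewrite mul_scalar_mx -mulmxA => /colP/(_ i0); rewrite [RHS]mxE => <-.
  rewrite mxE; apply: sumr_le0 => l _; rewrite mulr_ge0_le0 //.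
    exact: proper_semimonotone_adj_ge0.
  by rewrite ltW // Mtx.
rewrite ltNge; apply/negP => d0.
(* If [det M >= 0], the determinant passes from nonnegative at [0] to nonpositive at [t]; the root
   in between contradicts [nz]. The negation gives the order of signs that [poly_ivt] expects. *)
have [||s /andP[s0 st]] := @poly_ivt R (- char_poly (- M)) 0 t; first exact: ltW.
  rewrite !hornerN !horner_char_polyN oppr_le0 oppr_ge0 dt andbT.
  by rewrite raddf0 addr0.
by rewrite rootN /root horner_char_polyN (negPf (nz s _ _)) // (le_lt_trans st).
Qed.

(** A vector refuting semimonotonicity has full support, since a zero entry would bring it under
    [pM]. *)
Lemma not_semimonotone_pos (R : realType) (m : nat) (M : 'M[R]_m) :
  proper_semimonotone M -> ~ semimonotone M ->
  exists x : 'cV[R]_m,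
    (forall i, 0 < x i 0) /\ (forall i, (M *m x) i 0 < 0).
Proof.
move=> pM /existsNP[x /not_implyP[x0 /not_implyP[xge /forallNP H]]].
have xpos i : 0 < x i 0.
  rewrite lt_neqAle xge andbT eq_sym; apply/eqP => xi.
  by have [j /H] := pM i x x0 xge xi.
by exists x; split=> // i; rewrite ltNge; apply/negP => Mx; apply: (H i).
Qed.

(** * Principal submatrices of E02-matrices *)

Lemma superset_card (T : finType) (J : {set T}) (k : nat) :
  (#|J| <= k <= #|T|)%N -> exists K : {set T}, J \subset K /\ #|K| = k.
Proof.
move=> /andP[Jk kT].
have /card_geqP[s [us ss /subsetP sJ]] : (k - #|J| <= #|~: J|)%N.
  by rewrite [#|~: J|]cardsCs setCK leq_sub2r.
exists (J :|: [set x in s]); split; first exact: subsetUl.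
rewrite cardsU disjoint_setI0 ?cards0 ?subn0.
  by rewrite cardsE (card_uniqP us) ss subnKC.
rewrite disjoint_sym disjoints_subset; apply/subsetP => x.
by rewrite inE => xs; apply: (subsetP sJ).
Qed.

Lemma semimonotone_principal (R : realType) (n : nat) (A : 'M[R]_n)
    (J : {set 'I_n}) :
  semimonotone (principal_submx A J) <->
  (forall x : 'cV[R]_n, x != 0 -> (forall i, 0 <= x i 0) ->
     (forall i, i \notin J -> x i 0 = 0) ->
     exists i, 0 < x i 0 /\ 0 <= (A *m x) i 0).
Proof.
have cJ : codom (@enum_val _ (mem J)) =i J.
  move=> i; apply/codomP/idP => [[j ->]|iJ]; first exact: enum_valP.
  by exists (enum_rank_in iJ i); rewrite enum_rankK_in.
apply: (iff_trans (semimonotone_mxsub A (@enum_val_inj _ (mem J)))).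
by split=> H x x0 xge xout; apply: H => // i iJ; apply: xout;
  rewrite ?cJ // -cJ.
Qed.

Lemma semimonotone_mxsub_principal (R : realType) (m n : nat)
    (f : 'I_m -> 'I_n) (A : 'M[R]_n) : injective f ->
  semimonotone (mxsub f f A) <->
  semimonotone (principal_submx A [set i in codom f]).
Proof.
move=> f_inj; rewrite semimonotone_principal semimonotone_mxsub //.
split=> H x x0 xge xout; apply: H => // i; last by rewrite inE; apply: xout.
by move=> iC; apply: xout; rewrite inE.
Qed.

(** Smaller orders inherit the condition at order [n - 2]: a vector supported on the image of [f] is
    supported on any superset [K] with [n - 2] elements. *)
Lemma E02_semimonotone_mxsub (R : realType) (m n : nat) (f : 'I_m -> 'I_n)
    (A : 'M[R]_n) : injective f -> E02_matrix A -> (m <= n - 2)%N ->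
  semimonotone (mxsub f f A).
Proof.
move=> f_inj [sA _] mn; apply/(semimonotone_mxsub_principal _ f_inj).
have [|K [JK Kn]] := @superset_card _ [set i in codom f] (n - 2).
  by rewrite cardsE card_codom // !card_ord mn leq_subr.
have /semimonotone_principal H := sA K Kn.
apply/semimonotone_principal => x x0 xge xout; apply: H => // i iK.
by apply: xout; apply: contra iK; apply: (subsetP JK).
Qed.

Lemma E02_proper_semimonotone (R : realType) (m n : nat) (f : 'I_m -> 'I_n)
    (A : 'M[R]_n) : injective f -> E02_matrix A -> (m <= n - 1)%N ->
  proper_semimonotone (mxsub f f A).
Proof.
move=> f_inj EA mn; apply/proper_semimonotoneP => k.
have -> : mxsub (lift k) (lift k) (mxsub f f A)
    = mxsub (f \o lift k) (f \o lift k) A.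
  by apply/matrixP => i j; rewrite !mxE.
apply: E02_semimonotone_mxsub => //.
  by apply: inj_comp => //; exact: lift_inj.
by rewrite -subn1 (leq_trans (leq_sub2r 1 mn)) // -subnDA.
Qed.

Lemma E02_mxsub_pos (R : realType) (m n : nat) (f : 'I_m -> 'I_n)
    (A : 'M[R]_n) : injective f -> E02_matrix A -> m = (n - 1)%N ->
  exists x : 'cV[R]_m,
    (forall i, 0 < x i 0) /\ (forall i, (mxsub f f A *m x) i 0 < 0).
Proof.
move=> f_inj EA mn; apply: not_semimonotone_pos.
  by apply: E02_proper_semimonotone => //; rewrite mn.
move/(semimonotone_mxsub_principal _ f_inj); apply: EA.2; left.
by rewrite cardsE card_codom // card_ord.
Qed.

Lemma E02_Z_det_mxsub_lt0 (R : realType) (m n : nat) (f : 'I_m -> 'I_n)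
    (A : 'M[R]_n) : (1 < n)%N -> injective f -> Z_matrix A -> E02_matrix A ->
  m = (n - 1)%N -> \det (mxsub f f A) < 0.
Proof.
move=> n1 f_inj ZA EA mn; have [x [x0 Ax]] := E02_mxsub_pos f_inj EA mn.
apply: proper_semimonotone_det_lt0 x0 Ax.
- by rewrite mn subn_gt0.
- exact: Z_matrix_mxsub.
- by apply: E02_proper_semimonotone => //; rewrite mn.
Qed.

(** * Signs and determinant of the full matrix *)

Lemma E02_Z_sign (R : realType) (n : nat) (A : 'M[R]_n) (k : 'I_n)
    (y : 'cV[R]_n) :
  Z_matrix A -> E02_matrix A -> y k 0 <= 0 ->
  (forall i, i != k -> (A *m y) i 0 <= 0) ->
  forall i, i != k -> 0 <= y i 0.
Proof.
move=> ZA EA yk Ay i; rewrite eq_sym => /unlift_some[j -> _].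
have n1 : n.-1 = (n - 1)%N by rewrite subn1.
have [x [x0 Ax]] := E02_mxsub_pos (@lift_inj _ k) EA n1.
have pB : proper_semimonotone (mxsub (lift k) (lift k) A).
  by apply: E02_proper_semimonotone; rewrite ?n1 //; exact: lift_inj.
have := proper_semimonotone_inv (u := rowsub (lift k) y) pB x0 Ax _ j.
rewrite mxE; apply.
move=> l; have lk : lift k l != k by rewrite eq_sym neq_lift.
(* The column [k] term to be subtracted is a product of two nonpositive numbers, so the right side
   remains nonpositive. *)
have -> : (mxsub (lift k) (lift k) A *m rowsub (lift k) y) l 0
    = (A *m y) (lift k l) 0 - A (lift k l) k * y k 0.
  rewrite !mxE (bigD1_ord k) //= addrAC subrr add0r.
  by apply: eq_bigr => i' _; rewrite !mxE.
by rewrite subr_le0 (le_trans (Ay _ lk)) // mulr_le0 // ZA.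
Qed.

Lemma E02_Z_det_neq0 (R : realType) (n : nat) (A : 'M[R]_n) :
  (2 < n)%N -> Z_matrix A -> E02_matrix A -> \det A != 0.
Proof.
move=> n2 ZA EA; rewrite -det_tr; apply/det0P => -[v /eqP v0 vA].
have {}vA : A *m v^T = 0.
  by rewrite -[_ *m _]trmxK trmx_mul trmxK vA trmx0.
have neg k : v 0 k <= 0 -> forall i, i != k -> 0 <= v 0 i.
  move=> vk i ik; have := @E02_Z_sign _ _ _ k v^T ZA EA _ _ i ik.
  by rewrite !mxE; apply=> // j _; rewrite vA mxE.
have pos k : 0 <= v 0 k -> forall i, i != k -> v 0 i <= 0.
  move=> vk i ik; have := @E02_Z_sign _ _ _ k (- v^T) ZA EA _ _ i ik.
  rewrite !mxE oppr_le0 oppr_ge0; apply=> // j _.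
  by rewrite mulmxN vA !mxE oppr0.
have third (i k : 'I_n) : exists j, j != i /\ j != k.
  have /card_gt0P[j] : (0 < #|~: [set i; k]|)%N.
    rewrite cardsCs setCK card_ord subn_gt0 (leq_ltn_trans _ n2) //.
    by rewrite cards2; case: eqP.
  by rewrite !inE negb_or => /andP[]; exists j.
apply: v0; apply/rowP => i; apply/eqP; rewrite mxE eq_le.
have [j [ji _]] := third i i; have [l [li lj]] := third i j.
have ij : i != j by rewrite eq_sym.
have il : i != l by rewrite eq_sym.
(* Passing to another index reverses the weak sign. The cycle [i], [j], [l], [i] makes three
   reversals, which forces [v 0 i = 0]. *)
case: (leP (v 0 i) 0) => vi /=.
  exact: neg (pos j (neg i vi j ji) l lj) i il.
have := pos l (neg j (pos i (ltW vi) j ji) l lj) i il.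
by rewrite leNgt vi.
Qed.

Lemma E02_Z_det_lt0 (R : realType) (n : nat) (A : 'M[R]_n) :
  (2 < n)%N -> Z_matrix A -> E02_matrix A -> \det A < 0.
Proof.
move=> n2 ZA EA; rewrite lt_neqAle E02_Z_det_neq0 //=.
pose k := Ordinal (ltn_trans (ltn0Sn 1) n2); pose y := col k (\adj A).
have n1 : n.-1 = (n - 1)%N by rewrite subn1.
have yk : y k 0 <= 0.
  rewrite !mxE cofactor_mxsub ltW // E02_Z_det_mxsub_lt0 //.
  - exact: ltnW.
  - exact: lift_inj.
have ypos : forall i, i != k -> 0 <= y i 0.
  apply: (E02_Z_sign ZA EA yk) => i ik.
  by rewrite mul_adj_col (negPf ik).
(* Order [1] is at most [n - 2] because [2 < n]; the constant map [f] selects this submatrix. *)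
have Akk : 0 <= A k k.
  pose f (i : 'I_1) := k.
  have f_inj : injective f by move=> i j; rewrite !ord1.
  have := semimonotone_diag_ge0 0 (E02_semimonotone_mxsub f_inj EA _).
  by rewrite mxE; apply; rewrite subn_gt0.
(* In row [k] of [A y], the diagonal term pairs [A k k >= 0] with [y_k <= 0], and every other term
   pairs a nonpositive entry with [y_j >= 0]. *)
have := mul_adj_col A k k; rewrite eqxx mulr1n => <-.
rewrite mxE; apply: sumr_le0 => j _.
have [->|jk] := eqVneq j k; first exact: mulr_ge0_le0.
by apply: mulr_le0_ge0; [apply: ZA; rewrite eq_sym | exact: ypos].
Qed.

Theorem theorem3p9 (R : realType) (n : nat) (A : 'M[R]_n)
    (hn : (2 < n)%N) (hZ : Z_matrix A) (hE : E02_matrix A) :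
  (forall J : {set 'I_n}, (#|J| <= n - 2)%N -> 0 <= principal_minor A J) /\
  (forall J : {set 'I_n}, #|J| = (n - 1)%N -> principal_minor A J < 0) /\
  \det A < 0 /\
  (A \in unitmx /\ forall i, 0 < invmx A i i).
Proof.
have dA := E02_Z_det_lt0 hn hZ hE.
have uA : A \in unitmx by rewrite unitmxE unitfE lt_eqF.
have val_inj (J : {set 'I_n}) := @enum_val_inj _ (mem J).
split=> [J Jn|]; last split=> [J Jn|].
- have := Z_semimonotone_det_ge0 (t := 0) (Z_matrix_mxsub (val_inj J) hZ)
    (E02_semimonotone_mxsub (val_inj J) hE Jn) (lexx 0).
  by rewrite raddf0 addr0.
- exact: E02_Z_det_mxsub_lt0 (ltnW hn) (val_inj J) hZ hE Jn.
do 2!split=> //; move=> i.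
(* A diagonal entry of the inverse is a principal minor of order [n - 1] divided by [det A], both
   negative. *)
rewrite /invmx uA mxE mxE cofactor_mxsub nmulr_rgt0 ?invr_lt0 //.
by apply: E02_Z_det_mxsub_lt0; rewrite ?subn1 //;
  [exact: ltnW | exact: lift_inj].
Qed.
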